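(* Let $p$ be a prime, $S$ a finite $p$-group, $\mathcal F$ a saturated fusion system on $S$, and $\mathbb K$ a subfield of $\mathbb C$. The representation ring $R_{\mathbb K}(\mathcal F)$ is the Grothendieck ring of the representation semiring $R^+_{\mathbb K}(\mathcal F)$ (that is, the homomorphism from the Grothendieck ring of $R^+_{\mathbb K}(\mathcal F)$ to $R_{\mathbb K}(S)$ induced by the inclusion $R^+_{\mathbb K}(\mathcal F)\subseteq R^+_{\mathbb K}(S)$ is an isomorphism onto $R_{\mathbb K}(\mathcal F)$).
   Context: A fusion system $\mathcal F$ on a finite $p$-group $S$ is a category whose objects are the subgroups of $S$ and whose morphism sets $\mathcal F(P,Q)$ satisfy: $\mathrm{Hom}_S(P,Q)\subseteq \mathcal F(P,Q)\subseteq \mathrm{Inj}(P,Q)$, where $\mathrm{Inj}(P,Q)$ is the set of injective group homomorphisms and $\mathrm{Hom}_S(P,Q)$ the set of homomorphisms induced by conjugation by elements of $S$; and every $\varphi\in\mathcal F(P,Q)$ factors in $\mathcal F$ as $P\xrightarrow{\varphi}\varphi P\hookrightarrow Q$ with $\varphi^{-1}\colon\varphi P\to P$ also in $\mathcal F$. Subgroups (or elements) are $\mathcal F$-conjugate if connected by an isomorphism in $\mathcal F$. $P\le S$ is fully $\mathcal F$-centralized (resp. fully $\mathcal F$-normalized) if $|C_S(P)|\ge|C_S(P')|$ (resp. $|N_S(P)|\ge|N_S(P')|$) for all $P'$ $\mathcal F$-conjugate to $P$. $\mathcal F$ is saturated if: (1) every fully $\mathcal F$-normalized $P$ is fully $\mathcal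 F$-centralized and $\mathrm{Aut}_S(P)$ is a Sylow $p$-subgroup of $\mathrm{Aut}_{\mathcal F}(P)$; (2) if $\varphi\in\mathcal F(P,S)$ has fully $\mathcal F$-centralized image, then $\varphi$ extends to some $\tilde\varphi\in\mathcal F(N_\varphi,S)$, where $N_\varphi=\{x\in N_S(P)\mid \exists y\in N_S(\varphi P)\colon \varphi\circ c_x=c_y\circ\varphi\}$. $R^+_{\mathbb K}(S)$ is the semiring of isomorphism classes of finite-dimensional representations of $S$ over $\mathbb K$, with $\oplus$ as addition and $\otimes_{\mathbb K}$ as multiplication; $R_{\mathbb K}(S)$ is its Grothendieck ring, whose elements are virtual representations $U-V$. For $\varphi\in\mathcal F(P,S)$, $\mathrm{res}_\varphi V$ is $V$ with $P$ acting by $x\cdot v=\varphi(x)v$, extended linearly to virtual representations; $\mathrm{res}_P$ is ordinary restriction to $P$. A (virtual) representation $V$ of $S$ is $\mathcal F$-stable if $\mathrm{res}_\varphi V=\mathrm{res}_P V$ for all $P\le S$ and $\varphi\in\mathcal F(P,S)$. $R_{\mathbb K}(\mathcal F)\subseteq R_{\mathbb K}(S)$ is the subring of $\mathcal F$-stable virtual representations, and $R^+_{\mathbb K}(\mathcal F)\subseteq R^+_{\mathbb K}(S)$ is the subsemiring of $\mathcal F$-stable representations. *)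

(* Defs.v *)
From HB Require Import structures.
From mathcomp Require Import all_boot all_order all_algebra all_fingroup.
From mathcomp Require Import all_solvable all_field all_character.
From mathcomp Require Import boolp generic_quotient ring.

Set Implicit Arguments.
Unset Strict Implicit.
Unset Printing Implicit Defensive.

Import GRing.Theory.
Local Open Scope ring_scope.
Local Open Scope quotient_scope.

Section Isomorphisms.

Variables (K : fieldType) (gT : finGroupType) (G : {group gT}).
Implicit Types U V W : representation K G.

Lemma rsim_bij U V (f : 'I_(rdegree U) -> 'I_(rdegree V)) :
    bijective f ->
    (forall g, g \in G -> forall i j, U g i j = V g (f i) (f j)) ->
  mx_rsim U V.
Proof.
case: U f => m U; case: V => n V /= f bij_f eqUV.
have eq_mn : m = n by rewrite -(card_ord m) -(card_ord n) (bij_eq_card bij_f).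
subst n; pose s := perm (bij_inj bij_f).
exists (perm_mx s) => // [|g Gg].
  by rewrite row_free_unit unitmx_perm.
rewrite -row_permE; have:= col_permE s^-1%g (U g); rewrite invgK => <-.
apply/matrixP=> i j; rewrite !mxE (eqUV g Gg); 
congr (V g _ _); first by rewrite permE.
by rewrite -[f _](permE (bij_inj bij_f)) permKV.
Qed.

(* U has matrix entries M in some basis indexed by the finite type I. *)
Definition realizes U (I : finType) (M : gT -> I -> I -> K) :=
  exists2 e : I -> 'I_(rdegree U), bijective e &
    forall g, g \in G -> forall i j, U g (e i) (e j) = M g i j.

Lemma realizes_id U : realizes U (fun g i j => U g i j).
Proof. by exists id => //; exists id. Qed.

Lemma realizes_rsim U V (I J : finType) M N (h : I -> J) :
    @realizes U I M -> @realizes V J N -> bijective h ->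
    (forall g i j, M g i j = N g (h i) (h j)) ->
  mx_rsim U V.
Proof.
case=> e bij_e eM [e' bij_e' eN] bij_h eqMN; have [d eK dK] := bij_e.
apply: (@rsim_bij _ _ (e' \o (h \o d))) => [|g Gg i j].
  by do 2![apply: bij_comp => //]; exists e.
by rewrite -{1}[i]dK -{1}[j]dK eM // eqMN eN.
Qed.

Definition dadd_coef (I J : finType) (M : gT -> I -> I -> K)
    (N : gT -> J -> J -> K) g (x y : I + J) :=
  match x, y with
  | inl i, inl j => M g i j
  | inr i, inr j => N g i j
  | _, _ => 0
  end.

Lemma realizes_dadd U V I J M N :
    @realizes U I M -> @realizes V J N ->
  realizes (dadd_grepr U V) (dadd_coef M N).
Proof.
case=> e [d eK dK] eM [e' [d' eK' dK'] eN].
pose f (x : I + J) : 'I_(rdegree U) + 'I_(rdegree V) :=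
  match x with inl i => inl (e i) | inr j => inr (e' j) end.
pose f' (x : 'I_(rdegree U) + 'I_(rdegree V)) : I + J :=
  match x with inl i => inl (d i) | inr j => inr (d' j) end.
exists (fun x => unsplit (f x)).
  exists (fun k => f' (split k)) => [x|k]; rewrite ?unsplitK.
    by case: x => i /=; rewrite ?eK ?eK'.
  by rewrite -[RHS]splitK; case: (split k) => i /=; rewrite ?dK ?dK'.
move=> g Gg [i|i] [j|j] /=.
- by rewrite block_mxEul eM.
- by rewrite block_mxEur mxE.
- by rewrite block_mxEdl mxE.
- by rewrite block_mxEdr eN.
Qed.

Lemma pidx_subproof m n (i : 'I_m) (j : 'I_n) : (i * n + j < m * n)%N.
Proof.
apply: (@leq_trans (i.+1 * n)); first by rewrite mulSn addnC ltn_add2r.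
by rewrite leq_mul2r ltn_ord orbT.
Qed.

Definition pidx m n (x : 'I_m * 'I_n) : 'I_(m * n) :=
  Ordinal (pidx_subproof x.1 x.2).

Lemma pidx_bij m n : bijective (@pidx m n).
Proof.
apply: inj_card_bij; last by rewrite card_prod !card_ord.
move=> [i j] [i' j'] /(congr1 val) /= eq_ij.
have n_gt0 : (0 < n)%N by exact: leq_ltn_trans (leq0n j) (ltn_ord j).
have eq_i : i = i' :> nat.
  have:= congr1 (divn^~ n) eq_ij.
  by rewrite /= !divnMDl // !divn_small ?addn0.
congr pair; first exact: val_inj.
by apply: val_inj; move: eq_ij; rewrite eq_i => /addnI.
Qed.

Lemma trowE n1 (A : 'rV[K]_n1) m2 n2 (B : 'M[K]_(m2, n2)) s j l :
  trow A B s (pidx (j, l)) = A 0 j * B s l.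
Proof.
elim: n1 A j => [|n1 IHn] A j; first by case: j.
case: (unliftP ord0 j) => [{}j|] -> /=; last first.
  have ->: pidx (ord0, l) = lshift (n1 * n2) l :> 'I_(n2 + n1 * n2).
    exact: val_inj.
  by rewrite row_mxEl !mxE; congr (A _ _ * _); apply: val_inj.
have ->: pidx (lift ord0 j, l) = rshift n2 (pidx (j, l)) :> 'I_(n2 + n1 * n2).
  by apply: val_inj; rewrite /= mulSn addnA.
by rewrite row_mxEr IHn !mxE; congr (A _ _ * _); apply: val_inj.
Qed.

Lemma tprod_pidx m1 n1 (A : 'M[K]_(m1, n1)) m2 n2 (B : 'M[K]_(m2, n2)) x y :
  tprod A B (pidx x) (pidx y) = A x.1 y.1 * B x.2 y.2.
Proof.
case: x y => [i k] [j l] /=; elim: m1 A i => [|m1 IHm] A i; first by case: i.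
case: (unliftP ord0 i) => [{}i|] -> /=; last first.
  have ->: pidx (ord0, k) = lshift (m1 * m2) k :> 'I_(m2 + m1 * m2).
    exact: val_inj.
  by rewrite col_mxEu trowE !mxE; congr (A _ _ * _); apply: val_inj.
have ->: pidx (lift ord0 i, k) = rshift m2 (pidx (i, k)) :> 'I_(m2 + m1 * m2).
  by apply: val_inj; rewrite /= mulSn addnA.
by rewrite col_mxEd IHm !mxE; congr (A _ _ * _); apply: val_inj.
Qed.

Definition prod_coef (I J : finType) (M : gT -> I -> I -> K)
    (N : gT -> J -> J -> K) g (x y : I * J) := M g x.1 y.1 * N g x.2 y.2.

Definition prod_grepr U V := Representation (prod_repr U V).

Lemma realizes_prod U V I J M N :
    @realizes U I M -> @realizes V J N ->
  realizes (prod_grepr U V) (prod_coef M N).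
Proof.
case=> e [d eK dK] eM [e' [d' eK' dK'] eN].
exists (fun x => pidx (e x.1, e' x.2)).
  apply: (bij_comp (@pidx_bij _ _)).
  by exists (fun x => (d x.1, d' x.2)) => [[i j]|[i j]] /=;
    rewrite ?eK ?eK' ?dK ?dK'.
by move=> g Gg [i j] [i' j'] /=; rewrite tprod_pidx /= eM ?eN.
Qed.

Lemma one_mx_repr : mx_repr G (fun=> 1%:M : 'M[K]_1).
Proof. by split=> [|x y _ _]; rewrite ?mulmx1. Qed.

Definition grepr1 := Representation (MxRepresentation one_mx_repr).

Lemma realizes0 : realizes grepr0 (fun _ (i : void) (_ : void) => of_void K i).
Proof.
exists (of_void 'I_0) => [|g _ []].
by apply: inj_card_bij => [[]|]; rewrite card_ord.
Qed.

Lemma realizes1 : realizes grepr1 (fun _ (_ _ : unit) => 1).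
Proof.
exists (fun=> ord0) => [|g _ _ _ /=]; last by rewrite mxE.
by exists (fun=> tt) => [[]|i] //=; rewrite [RHS]ord1.
Qed.

Let re := realizes_id.
Let rD := realizes_dadd.
Let rM := realizes_prod.

Lemma dadd_rsimC U V : mx_rsim (dadd_grepr U V) (dadd_grepr V U).
Proof.
pose h (A B : Type) (x : A + B) : B + A :=
  match x with inl a => inr a | inr b => inl b end.
apply: (realizes_rsim (rD (re U) (re V)) (rD (re V) (re U)) (h := @h _ _)).
  by exists (@h _ _) => [[]|[]].
by move=> g [i|i] [j|j].
Qed.

Lemma dadd_rsimA U V W :
  mx_rsim (dadd_grepr U (dadd_grepr V W)) (dadd_grepr (dadd_grepr U V) W).
Proof.
pose h (A B C : Type) (x : A + (B + C)) : (A + B) + C := match x with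
  | inl a => inl (inl a) | inr (inl b) => inl (inr b) | inr (inr c) => inr c end.
pose h' (A B C : Type) (x : (A + B) + C) : A + (B + C) := match x with
  | inl (inl a) => inl a | inl (inr b) => inr (inl b) | inr c => inr (inr c) end.
apply: (realizes_rsim (rD (re U) (rD (re V) (re W)))
                      (rD (rD (re U) (re V)) (re W)) (h := @h _ _ _)).
  by exists (@h' _ _ _) => [[|[]]|[[]|]].
by move=> g [i|[i|i]] [j|[j|j]].
Qed.

Lemma dadd0_rsim U : mx_rsim (dadd_grepr grepr0 U) U.
Proof.
apply: (realizes_rsim (rD realizes0 (re U)) (re U)
  (h := fun x => match x with inl v => of_void _ v | inr i => i end)).
  by exists inr => [[[]|]|].
by move=> g [[]|i] [[]|j].
Qed.

Lemma prod_rsimC U V : mx_rsim (prod_grepr U V) (prod_grepr V U).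
Proof.
apply: (realizes_rsim (rM (re U) (re V)) (rM (re V) (re U))
  (h := fun x => (x.2, x.1))).
  by exists (fun x => (x.2, x.1)) => [[]|[]].
by move=> g [i i'] [j j']; rewrite /prod_coef mulrC.
Qed.

Lemma prod_rsimA U V W :
  mx_rsim (prod_grepr U (prod_grepr V W)) (prod_grepr (prod_grepr U V) W).
Proof.
apply: (realizes_rsim (rM (re U) (rM (re V) (re W)))
                      (rM (rM (re U) (re V)) (re W))
  (h := fun x => ((x.1, x.2.1), x.2.2))).
  by exists (fun x => (x.1.1, (x.1.2, x.2))) => [[? []]|[[]]].
by move=> g [i [i' i'']] [j [j' j'']]; rewrite /prod_coef mulrA.
Qed.

Lemma prod1_rsim U : mx_rsim (prod_grepr grepr1 U) U.
Proof.
apply: (realizes_rsim (rM realizes1 (re U)) (re U) (h := snd)).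
  by exists (pair tt) => [[[]]|].
by move=> g [[] i] [[] j]; rewrite /prod_coef mul1r.
Qed.

Lemma prod0_rsim U : mx_rsim (prod_grepr grepr0 U) grepr0.
Proof.
apply: (realizes_rsim (rM realizes0 (re U)) realizes0 (h := fst)).
  by exists (of_void _) => [[]|] [].
by move=> g [].
Qed.

Lemma prod_daddl_rsim U V W :
  mx_rsim (prod_grepr (dadd_grepr U V) W)
          (dadd_grepr (prod_grepr U W) (prod_grepr V W)).
Proof.
pose h (A B C : Type) (x : (A + B) * C) : A * C + B * C := match x with
  | (inl a, c) => inl (a, c) | (inr b, c) => inr (b, c) end.
pose h' (A B C : Type) (x : A * C + B * C) : (A + B) * C := match x with
  | inl (a, c) => (inl a, c) | inr (b, c) => (inr b, c) end.
apply: (realizes_rsim (rM (rD (re U) (re V)) (re W))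
   (rD (rM (re U) (re W)) (rM (re V) (re W))) (h := @h _ _ _)).
  by exists (@h' _ _ _) => [[[]]|[[]|[]]].
by move=> g [[i|i] i'] [[j|j] j']; rewrite /prod_coef //= mul0r.
Qed.

Lemma dadd_rsim U U' V V' : mx_rsim U U' -> mx_rsim V V' ->
  mx_rsim (dadd_grepr U V) (dadd_grepr U' V').
Proof.
case: U U' V V' => [m U] [m' U'] [n V] [n' V'] /=.
case=> A eqm; subst m'; rewrite row_free_unit => uA simA.
case=> B eqn; subst n'; rewrite row_free_unit => uB simB.
exists (block_mx A 0 0 B) => // [|g Gg] /=.
  by rewrite row_free_unit unitmxE det_ublock unitrM -!unitmxE uA uB.
by rewrite !mulmx_block !(mulmx0, mul0mx, addr0, add0r) simA ?simB.
Qed.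

Lemma prod_rsim U U' V V' : mx_rsim U U' -> mx_rsim V V' ->
  mx_rsim (prod_grepr U V) (prod_grepr U' V').
Proof.
case: U U' V V' => [m U] [m' U'] [n V] [n' V'] /=.
case=> A eqm; subst m'; rewrite row_free_unit => uA simA.
case=> B eqn; subst n'; rewrite row_free_unit => uB simB.
exists (tprod A B) => // [|g Gg] /=; last by rewrite -!tprodE simA ?simB.
apply/row_freeP; exists (tprod (invmx A) (invmx B)).
by rewrite -tprodE !mulmxV ?tprod1.
Qed.

End Isomorphisms.

Section RepSemiring.

Variables (K : fieldType) (gT : finGroupType) (G : {group gT}).

HB.instance Definition _ := gen_eqMixin (representation K G).
HB.instance Definition _ := gen_choiceMixin (representation K G).

Definition rep_iso (U V : representation K G) : bool := `[< mx_rsim U V >].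

Lemma rep_iso_equiv : equiv_class_of rep_iso.
Proof.
split=> [U|U V|V U W]; first exact/asboolP/mx_rsim_refl.
  by apply/idP/idP=> /asboolP/mx_rsim_sym/asboolP.
by move=> /asboolP UV /asboolP VW; apply/asboolP/(mx_rsim_trans UV VW).
Qed.

Canonical rep_iso_equivRel := EquivRelPack rep_iso_equiv.

Definition rep_semiring := {eq_quot rep_iso}.
HB.instance Definition _ := Choice.on rep_semiring.
HB.instance Definition _ := EqQuotient.on rep_semiring.

Definition rep_class (U : representation K G) : rep_semiring := \pi U.

Lemma rep_classP U V : rep_class U = rep_class V <-> mx_rsim U V.
Proof. by split=> [/eqmodP/asboolP|/asboolP UV]; last exact/eqmodP. Qed.

Lemma rep_classK x : rep_class (repr x) = x.
Proof. exact: reprK. Qed.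

Lemma rep_class_repr U : mx_rsim (repr (rep_class U)) U.
Proof. by apply/rep_classP; rewrite rep_classK. Qed.

Definition rep_add (x y : rep_semiring) :=
  rep_class (dadd_grepr (repr x) (repr y)).
Definition rep_mul (x y : rep_semiring) :=
  rep_class (prod_grepr (repr x) (repr y)).
Definition rep_zero := rep_class grepr0.
Definition rep_one := rep_class (grepr1 K G).

Fact rep_addE U V :
  rep_add (rep_class U) (rep_class V) = rep_class (dadd_grepr U V).
Proof. by apply/rep_classP/dadd_rsim; apply: rep_class_repr. Qed.

Fact rep_mulE U V :
  rep_mul (rep_class U) (rep_class V) = rep_class (prod_grepr U V).
Proof. by apply/rep_classP/prod_rsim; apply: rep_class_repr. Qed.

Lemma rep_classW (P : rep_semiring -> Prop) :
  (forall U, P (rep_class U)) -> forall x, P x.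
Proof. by move=> PU x; rewrite -[x]rep_classK. Qed.

Fact rep_addA : associative rep_add.
Proof.
elim/rep_classW=> U; elim/rep_classW=> V; elim/rep_classW=> W.
by rewrite !rep_addE; apply/rep_classP/dadd_rsimA.
Qed.

Fact rep_addC : commutative rep_add.
Proof.
elim/rep_classW=> U; elim/rep_classW=> V.
by rewrite !rep_addE; apply/rep_classP/dadd_rsimC.
Qed.

Fact rep_add0 : left_id rep_zero rep_add.
Proof.
by elim/rep_classW=> U; rewrite rep_addE; apply/rep_classP/dadd0_rsim.
Qed.

HB.instance Definition _ :=
  GRing.isNmodule.Build rep_semiring rep_addA rep_addC rep_add0.

Fact rep_mulA : associative rep_mul.
Proof.
elim/rep_classW=> U; elim/rep_classW=> V; elim/rep_classW=> W.
by rewrite !rep_mulE; apply/rep_classP/prod_rsimA.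
Qed.

Fact rep_mulC : commutative rep_mul.
Proof.
elim/rep_classW=> U; elim/rep_classW=> V.
by rewrite !rep_mulE; apply/rep_classP/prod_rsimC.
Qed.

Fact rep_mul1 : left_id rep_one rep_mul.
Proof.
by elim/rep_classW=> U; rewrite rep_mulE; apply/rep_classP/prod1_rsim.
Qed.

Fact rep_mulDl : left_distributive rep_mul +%R.
Proof.
elim/rep_classW=> U; elim/rep_classW=> V; elim/rep_classW=> W.
rewrite -[_ + _]/(rep_add _ _) -[_ + _ in RHS]/(rep_add _ _).
by rewrite !(rep_addE, rep_mulE); apply/rep_classP/prod_daddl_rsim.
Qed.

Fact rep_mul0 : left_zero 0 rep_mul.
Proof.
by elim/rep_classW=> U; rewrite rep_mulE; apply/rep_classP/prod0_rsim.
Qed.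

HB.instance Definition _ := GRing.Nmodule_isComPzSemiRing.Build rep_semiring
  rep_mulA rep_mulC rep_mul1 rep_mulDl rep_mul0.

Lemma rep_classD U V :
  rep_class (dadd_grepr U V) = rep_class U + rep_class V.
Proof. exact/esym/rep_addE. Qed.

Lemma rep_classM U V :
  rep_class (prod_grepr U V) = rep_class U * rep_class V.
Proof. exact/esym/rep_mulE. Qed.

End RepSemiring.

Section Grothendieck.

Variable A : comPzSemiRingType.
Implicit Types x y z : A * A.

Definition groth_eq x y : bool := `[< exists k, x.1 + y.2 + k = y.1 + x.2 + k >].

Lemma groth_eq_equiv : equiv_class_of groth_eq.
Proof.
split=> [x|x y|y x z]; first by apply/asboolP; exists 0.
  by apply/asboolP/asboolP=> -[k eq_k]; exists k; rewrite eq_k.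
move=> /asboolP[k eq_k] /asboolP[l eq_l]; apply/asboolP.
exists (y.1 + y.2 + k + l).
transitivity ((x.1 + y.2 + k) + (y.1 + z.2 + l)); first by ring.
by rewrite eq_k eq_l; ring.
Qed.

Canonical groth_eq_equivRel := EquivRelPack groth_eq_equiv.

Definition groth := {eq_quot groth_eq}.
HB.instance Definition _ := Choice.on groth.
HB.instance Definition _ := EqQuotient.on groth.

(* The formal difference x.1 - x.2. *)
Definition gdiff x : groth := \pi x.

Lemma gdiffP x y :
  gdiff x = gdiff y <-> exists k, x.1 + y.2 + k = y.1 + x.2 + k.
Proof. by split=> [/eqmodP/asboolP|eq_xy]; last exact/eqmodP/asboolP. Qed.

Lemma gdiffK u : gdiff (repr u) = u.
Proof. exact: reprK. Qed.

Lemma gdiffW (P : groth -> Prop) : (forall x, P (gdiff x)) -> forall u, P u.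
Proof. by move=> Px u; rewrite -[u]gdiffK. Qed.

Let add x y := (x.1 + y.1, x.2 + y.2).
Let opp x := (x.2, x.1).
Let mul x y := (x.1 * y.1 + x.2 * y.2, x.1 * y.2 + x.2 * y.1).

Definition groth_add (u v : groth) := gdiff (add (repr u) (repr v)).
Definition groth_opp (u : groth) := gdiff (opp (repr u)).
Definition groth_mul (u v : groth) := gdiff (mul (repr u) (repr v)).

Fact groth_addE x y : groth_add (gdiff x) (gdiff y) = gdiff (add x y).
Proof.
have [/gdiffP[k eq_k] /gdiffP[l eq_l]] := (gdiffK (gdiff x), gdiffK (gdiff y)).
apply/gdiffP; move: (repr (gdiff x)) (repr (gdiff y)) eq_k eq_l => x' y' eq_k eq_l /=.
exists (k + l).
transitivity ((x'.1 + x.2 + k) + (y'.1 + y.2 + l)); first by ring.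
by rewrite eq_k eq_l; ring.
Qed.

Fact groth_oppE x : groth_opp (gdiff x) = gdiff (opp x).
Proof.
have /gdiffP[k eq_k] := gdiffK (gdiff x); apply/gdiffP.
move: (repr _) eq_k => x' eq_k /=; exists k.
by rewrite [x'.2 + _]addrC -eq_k [x.2 + _]addrC.
Qed.

Fact groth_mulE x y : groth_mul (gdiff x) (gdiff y) = gdiff (mul x y).
Proof.
have [/gdiffP[k eq_k] /gdiffP[l eq_l]] := (gdiffK (gdiff x), gdiffK (gdiff y)).
transitivity (gdiff (mul x (repr (gdiff y)))).
  apply/gdiffP; move: (repr (gdiff x)) (repr (gdiff y)) eq_k eq_l => x' y' eq_k _ /=.
  exists (k * y'.1 + k * y'.2).
  transitivity ((x'.1 + x.2 + k) * y'.1 + (x.1 + x'.2 + k) * y'.2); first by ring.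
  by rewrite eq_k -{2}eq_k; ring.
apply/gdiffP; move: (repr _) eq_l => y' eq_l /=.
exists (l * x.1 + l * x.2).
transitivity (x.1 * (y'.1 + y.2 + l) + x.2 * (y.1 + y'.2 + l)); first by ring.
by rewrite eq_l -{2}eq_l; ring.
Qed.

Fact groth_addA : associative groth_add.
Proof.
elim/gdiffW=> x; elim/gdiffW=> y; elim/gdiffW=> z.
by rewrite !groth_addE /add !addrA.
Qed.

Fact groth_addC : commutative groth_add.
Proof.
elim/gdiffW=> x; elim/gdiffW=> y; rewrite !groth_addE /add.
by rewrite [x.1 + _]addrC [x.2 + _]addrC.
Qed.

Fact groth_add0 : left_id (gdiff (0, 0)) groth_add.
Proof. by elim/gdiffW=> -[a b]; rewrite groth_addE /add !add0r. Qed.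

Fact groth_addN : left_inverse (gdiff (0, 0)) groth_opp groth_add.
Proof.
elim/gdiffW=> x; rewrite groth_oppE groth_addE.
by apply/gdiffP; exists 0; rewrite /= addr0 add0r [x.2 + _]addrC.
Qed.

HB.instance Definition _ :=
  GRing.isZmodule.Build groth groth_addA groth_addC groth_add0 groth_addN.

Fact groth_mulA : associative groth_mul.
Proof.
elim/gdiffW=> x; elim/gdiffW=> y; elim/gdiffW=> z; rewrite !groth_mulE /mul /=.
by congr gdiff; congr pair; ring.
Qed.

Fact groth_mulC : commutative groth_mul.
Proof.
elim/gdiffW=> x; elim/gdiffW=> y; rewrite !groth_mulE /mul.
by congr gdiff; congr pair; ring.
Qed.

Fact groth_mul1 : left_id (gdiff (1, 0)) groth_mul.
Proof.
elim/gdiffW=> -[a b]; rewrite groth_mulE /mul /=.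
by congr gdiff; congr pair; ring.
Qed.

Fact groth_mulDl : left_distributive groth_mul +%R.
Proof.
elim/gdiffW=> x; elim/gdiffW=> y; elim/gdiffW=> z.
rewrite -[_ + _]/(groth_add _ _) -[_ + _ in RHS]/(groth_add _ _).
rewrite !(groth_addE, groth_mulE) /mul /add /=.
by congr gdiff; congr pair; ring.
Qed.

HB.instance Definition _ := GRing.Zmodule_isComPzRing.Build groth
  groth_mulA groth_mulC groth_mul1 groth_mulDl.

Lemma gdiffD x y : gdiff (x.1 + y.1, x.2 + y.2) = gdiff x + gdiff y.
Proof. exact/esym/groth_addE. Qed.

Lemma gdiffM x y :
  gdiff (x.1 * y.1 + x.2 * y.2, x.1 * y.2 + x.2 * y.1) = gdiff x * gdiff y.
Proof. exact/esym/groth_mulE. Qed.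

Lemma gdiffB a b : gdiff (a, b) = gdiff (a, 0) - gdiff (b, 0).
Proof.
rewrite -[- _]/(groth_opp _) groth_oppE -[_ + _]/(groth_add _ _) groth_addE.
by rewrite /add /= addr0 add0r.
Qed.

End Grothendieck.

Section GrothendieckMap.

Variables (A B : comPzSemiRingType) (f : {rmorphism A -> B}).

Definition groth_map (u : groth A) : groth B :=
  gdiff (f (repr u).1, f (repr u).2).

Lemma groth_mapE x : groth_map (gdiff x) = gdiff (f x.1, f x.2).
Proof.
apply/gdiffP; have /gdiffP[k eq_k] := gdiffK (gdiff x).
by exists (f k); rewrite /= -!rmorphD eq_k.
Qed.

Fact groth_map_is_zmod_morphism : zmod_morphism groth_map.
Proof.
elim/gdiffW=> -[a b]; elim/gdiffW=> -[c d].
have BE (C : comPzSemiRingType) (x y : C * C) :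
    gdiff x - gdiff y = gdiff (x.1 + y.2, x.2 + y.1).
  rewrite -[- _]/(groth_opp _) groth_oppE -[_ + _]/(groth_add _ _).
  by rewrite groth_addE.
by rewrite BE !groth_mapE BE /= !rmorphD.
Qed.

Fact groth_map_is_monoid_morphism : monoid_morphism groth_map.
Proof.
split; first by rewrite groth_mapE /= rmorph1 rmorph0.
elim/gdiffW=> x; elim/gdiffW=> y; rewrite -gdiffM !groth_mapE -gdiffM /=.
by rewrite !(rmorphD, rmorphM).
Qed.

HB.instance Definition _ :=
  GRing.isZmodMorphism.Build (groth A) (groth B) groth_map
    groth_map_is_zmod_morphism.
HB.instance Definition _ :=
  GRing.isMonoidMorphism.Build (groth A) (groth B) groth_map
    groth_map_is_monoid_morphism.

End GrothendieckMap.

Section Restriction.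

Variables (K : fieldType) (aT rT : finGroupType).
Variables (H : {group aT}) (G : {group rT}) (f : {morphism H >-> rT}).
Hypothesis sHG : H \subset (f @*^-1 G)%g.

(* res_f U: the same space, with x in H acting as f x. *)
Definition res_grepr (U : representation K G) : representation K H :=
  Representation (subg_repr (morphpre_repr f U) sHG).

Lemma res_rsim (U V : representation K G) :
  mx_rsim U V -> mx_rsim (res_grepr U) (res_grepr V).
Proof.
case=> B eq_mn freeB simB; exists B => // g Hg; apply: simB.
by have /morphpreP[] := subsetP sHG g Hg.
Qed.

Lemma rsim_eq (U V : representation K H) :
    rdegree U = rdegree V ->
    (forall (e : rdegree U = rdegree V) g, g \in H ->
       castmx (e, e) (U g) = V g) ->
  mx_rsim U V.
Proof.
case: U V => [m U] [n V] /= e eqUV; subst n; exists 1%:M => // [|g Hg].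
  by rewrite row_free_unit unitmx1.
by rewrite mulmx1 mul1mx -(eqUV (erefl _)).
Qed.

Definition rep_res (x : rep_semiring K G) : rep_semiring K H :=
  rep_class (res_grepr (repr x)).

Lemma rep_resE U : rep_res (rep_class U) = rep_class (res_grepr U).
Proof. by apply/rep_classP/res_rsim/rep_class_repr. Qed.

Fact rep_res_is_nmod_morphism : nmod_morphism rep_res.
Proof.
split=> [|x y].
  rewrite -[0]/(rep_class _) rep_resE; apply/rep_classP/rsim_eq => // e g _.
  by rewrite castmx_id.
elim/rep_classW: x => U; elim/rep_classW: y => V.
rewrite -rep_classD !rep_resE -rep_classD.
by apply/rep_classP/rsim_eq => // e g _; rewrite castmx_id.
Qed.

Fact rep_res_is_monoid_morphism : monoid_morphism rep_res.
Proof.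
split=> [|x y].
  rewrite -[1]/(rep_class _) rep_resE; apply/rep_classP/rsim_eq => // e g _.
  by rewrite castmx_id.
elim/rep_classW: x => U; elim/rep_classW: y => V.
rewrite -rep_classM !rep_resE -rep_classM.
by apply/rep_classP/rsim_eq => // e g _; rewrite castmx_id.
Qed.

HB.instance Definition _ :=
  GRing.isNmodMorphism.Build (rep_semiring K G) (rep_semiring K H) rep_res
    rep_res_is_nmod_morphism.
HB.instance Definition _ :=
  GRing.isMonoidMorphism.Build (rep_semiring K G) (rep_semiring K H) rep_res
    rep_res_is_monoid_morphism.

End Restriction.

Definition rep_ring (K : fieldType) (gT : finGroupType) (G : {group gT}) :=
  groth (rep_semiring K G).
HB.instance Definition _ K gT G := GRing.ComPzRing.on (@rep_ring K gT G).

Definition vrep_res (K : fieldType) (aT rT : finGroupType) (H : {group aT})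
    (G : {group rT}) (f : {morphism H >-> rT}) (sHG : H \subset (f @*^-1 G)%g) :
    {rmorphism rep_ring K G -> rep_ring K H} := groth_map (rep_res sHG).

Local Open Scope group_scope.

(* Morphisms P -> Q are functions on gT, which only matter on P. *)
Record fusion_system (gT : finGroupType) (S : {group gT}) := FusionSystem {
  fhom : {group gT} -> {group gT} -> pred (gT -> gT);
  fhom_ext : forall (P Q : {group gT}) f g,
    {in P, f =1 g} -> fhom P Q f = fhom P Q g;
  fhom_inj : forall (P Q : {group gT}) f, fhom P Q f ->
    [/\ P \subset S, Q \subset S, morphic P f, {in P &, injective f}
      & f @: P \subset Q];
  fhom_conj : forall (P Q : {group gT}) x, P \subset S -> Q \subset S ->
    x \in S -> P :^ x \subset Q -> fhom P Q (conjg^~ x);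
  fhom_comp : forall (P Q R : {group gT}) f g,
    fhom P Q f -> fhom Q R g -> fhom P R (g \o f);
  fhom_factor : forall (P Q : {group gT}) (f : {morphism P >-> gT})
    (injf : 'injm f), fhom P Q f ->
    fhom P (f @* P)%G f /\ fhom (f @* P)%G P (invm injf)
}.

Section FusionSystems.

Variables (gT : finGroupType) (S : {group gT}) (F : fusion_system S).
Implicit Types P Q : {group gT}.

Definition fconjugate P Q : Prop := exists f g,
  [/\ fhom F P Q f, fhom F Q P g, {in P, cancel f g} & {in Q, cancel g f}].

Definition fully_centralized P : Prop := P \subset S /\
  forall Q, fconjugate P Q -> (#|'C_S(Q)| <= #|'C_S(P)|)%N.

Definition fully_normalized P : Prop := P \subset S /\
  forall Q, fconjugate P Q -> (#|'N_S(Q)| <= #|'N_S(P)|)%N.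

Definition Aut_fus P : {set {perm gT}} := [set a in Aut P | fhom F P P a].

Lemma Aut_fus_group_set P : P \subset S -> group_set (Aut_fus P).
Proof.
move=> sPS; apply/group_setP; split=> [|a b].
  rewrite inE group1 /= (@fhom_ext _ _ F P P _ (conjg^~ 1)).
    by apply: fhom_conj; rewrite ?conjsg1.
  by move=> x _; rewrite perm1 /= conjg1.
rewrite inE => /andP[Aa Fa]; rewrite inE => /andP[Ab Fb].
rewrite inE groupM //=.
rewrite (@fhom_ext _ _ F P P _ (b \o a)); first exact: fhom_comp Fa Fb.
by move=> x _; rewrite permM.
Qed.

Definition Aut_conj P : {set {perm gT}} := conj_aut P @* 'N_S(P).

(* N_f; replacing (x, y) by their inverses, it does not matter that u ^ x is
   x^-1 * u * x rather than x * u * x^-1. *)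
Definition fus_ext_set P (f : {morphism P >-> gT}) : {set gT} :=
  [set x in 'N_S(P) | [exists y in 'N_S(f @* P),
     [forall u in P, f (u ^ x) == f u ^ y]]].

Fact fus_ext_group_set P (f : {morphism P >-> gT}) :
  group_set (fus_ext_set f).
Proof.
apply/group_setP; split=> [|x x'].
  rewrite inE group1; apply/exists_inP; exists 1; first exact: group1.
  by apply/forall_inP=> u _; rewrite !conjg1.
rewrite inE => /andP[Nx /exists_inP[y Ny /forall_inP eq_xy]].
rewrite inE => /andP[Nx' /exists_inP[y' Ny' /forall_inP eq_xy']].
rewrite inE groupM //; apply/exists_inP; exists (y * y').
  exact: groupM.
apply/forall_inP=> u Pu; rewrite !conjgM.
have Pux: u ^ x \in P by rewrite memJ_norm //; case/setIP: Nx.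
by rewrite (eqP (eq_xy' _ Pux)) (eqP (eq_xy _ Pu)).
Qed.

Canonical fus_ext P (f : {morphism P >-> gT}) := Group (fus_ext_group_set f).

Definition saturated (p : nat) : Prop :=
  (forall P, fully_normalized P ->
     fully_centralized P /\ p.-Sylow(Aut_fus P) (Aut_conj P))
  /\
  (forall P (f : {morphism P >-> gT}),
     fhom F P S f -> fully_centralized (f @* P)%G ->
   exists2 g : {morphism fus_ext f >-> gT},
     fhom F (fus_ext f) S g & {in P, g =1 f}).

Lemma fhom_dom P Q f : fhom F P Q f -> P \subset idm P @*^-1 S.
Proof. by case/fhom_inj=> sPS _ _ _ _; rewrite morphpre_idm subsetI subxx. Qed.

Lemma fhom_im P (f : {morphism P >-> gT}) :
  fhom F P S f -> P \subset f @*^-1 S.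
Proof. by case/fhom_inj=> _ _ _ _ sfPS; rewrite -sub_morphim_pre ?morphimEdom. Qed.

End FusionSystems.

Local Close Scope group_scope.

Section StableRepresentations.

Variables (K : fieldType) (gT : finGroupType) (S : {group gT}).
Variable F : fusion_system S.

(* Restriction to P is res along the inclusion idm P of P into S. *)
Definition rep_stable : {pred rep_semiring K S} := fun x =>
  `[< forall (P : {group gT}) (f : {morphism P >-> gT}) (Ff : fhom F P S f),
        rep_res (fhom_im Ff) x = rep_res (fhom_dom Ff) x >].

Lemma rep_stableP x : reflect
  (forall (P : {group gT}) (f : {morphism P >-> gT}) (Ff : fhom F P S f),
     rep_res (fhom_im Ff) x = rep_res (fhom_dom Ff) x)
  (x \in rep_stable).
Proof. exact: asboolP. Qed.

Fact rep_stable_semiring_closed : semiring_closed rep_stable.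
Proof.
do 2![split].
- by apply/rep_stableP=> P f Ff; rewrite !rmorph0.
- move=> x y /rep_stableP Fx /rep_stableP Fy; apply/rep_stableP=> P f Ff.
  by rewrite !rmorphD /= Fx Fy.
- by apply/rep_stableP=> P f Ff; rewrite !rmorph1.
- move=> x y /rep_stableP Fx /rep_stableP Fy; apply/rep_stableP=> P f Ff.
  by rewrite !rmorphM /= Fx Fy.
Qed.

HB.instance Definition _ := GRing.isSemiringClosed.Build
  (rep_semiring K S) rep_stable rep_stable_semiring_closed.

Record stable_rep_semiring := StableRep {
  stable_rep_val : rep_semiring K S;
  _ : stable_rep_val \in rep_stable
}.

HB.instance Definition _ := [isSub for stable_rep_val].
HB.instance Definition _ := [Choice of stable_rep_semiring by <:].
HB.instance Definition _ :=
  GRing.SubChoice_isSubComPzSemiRing.Build (rep_semiring K S)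
    (mem rep_stable) stable_rep_semiring rep_stable_semiring_closed.

Definition stable_rep_incl :
  {rmorphism stable_rep_semiring -> rep_semiring K S} := \val.

Definition vrep_stable : {pred rep_ring K S} := fun x =>
  `[< forall (P : {group gT}) (f : {morphism P >-> gT}) (Ff : fhom F P S f),
        vrep_res K (fhom_im Ff) x = vrep_res K (fhom_dom Ff) x >].

Lemma vrep_stableP x : reflect
  (forall (P : {group gT}) (f : {morphism P >-> gT}) (Ff : fhom F P S f),
     vrep_res K (fhom_im Ff) x = vrep_res K (fhom_dom Ff) x)
  (x \in vrep_stable).
Proof. exact: asboolP. Qed.

Fact vrep_stable_subring_closed : subring_closed vrep_stable.
Proof.
split=> [|x y|x y]; first by apply/vrep_stableP=> P f Ff; rewrite !rmorph1.
  move=> /vrep_stableP Fx /vrep_stableP Fy; apply/vrep_stableP=> P f Ff.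
  by rewrite !rmorphB /= Fx Fy.
move=> /vrep_stableP Fx /vrep_stableP Fy; apply/vrep_stableP=> P f Ff.
by rewrite !rmorphM /= Fx Fy.
Qed.

HB.instance Definition _ := GRing.isSubringClosed.Build
  (rep_ring K S) vrep_stable vrep_stable_subring_closed.

End StableRepresentations.

(* Main.v *)
Require Import Defs.
From HB Require Import structures.
From mathcomp Require Import all_boot all_order all_algebra all_fingroup.
From mathcomp Require Import all_solvable all_field all_character.
From mathcomp Require Import boolp classical_sets functions reals complex.
From mathcomp Require Import ring.

(** The point is that every representation of a finite group in characteristic
    0 is a direct summand of a multiple of the regular representation, and
    that the regular representation of S is stable under every injective
    homomorphism into S: restricted along an injective f : P -> S it is the
    permutation representation of P acting freely on S by right translation
    through f, so that it is |S : P| copies of the regular representation of P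
    whatever f is ([rep_res_reg], [reg_stable]).

    Let U - V be a stable virtual representation. Choose V' with
    V + V' = n reg ([rep_dvd_reg]). Then U - V = (U + V') - n reg, where n reg
    is stable, so that the virtual representation attached to U + V' is stable
    as well. For U + V' itself to be stable, an equality in the Grothendieck
    ring of the representations of P must give an isomorphism, that is, the
    semiring of representations of P must be cancellative. This gives
    surjectivity ([vrep_stable_diff]). Cancellation over S gives injectivity,
    since an equality between sums of stable representations that holds after
    adding some representation already holds without it.

    Cancellation ([rep_addrI]) and the summand property are both compatible
    with direct sums, so by Maschke's theorem ([rep_class_ind]) they only have
    to be checked for an irreducible W. An irreducible W is generated
    by any nonzero vector, so it is a quotient of the regular representation,
    and hence a summand by complete reducibility. For cancellation, an
    isomorphism between U + W and V + W is a block matrix; it can be modified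
    so that its W-to-W corner is invertible, and the Schur complement of that
    corner is then an isomorphism between U and V
    ([dadd_rsim_irrK]). *)

Set Implicit Arguments.
Unset Strict Implicit.
Unset Printing Implicit Defensive.

Import GRing.Theory.
Local Open Scope ring_scope.

(** * Cancellation and complements in the semiring of representations *)

Section Semisimple.

Variables (K : fieldType) (gT : finGroupType) (G : {group gT}).
Implicit Types U V W : representation K G.

(** Eliminating with the pivot d leaves the Schur complement a - b d^-1 c,
    which is an isomorphism from rU to rV. *)
Lemma dadd_rsim_unit_corner m k (rU rV : mx_representation K G m)
    (rW : mx_representation K G k) a b c d :
    block_mx a b c d \in unitmx -> d \in unitmx ->
    (forall x, x \in G -> block_mx (rU x) 0 0 (rW x) *m block_mx a b c d
                        = block_mx a b c d *m block_mx (rV x) 0 0 (rW x)) ->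
  mx_rsim rU rV.
Proof.
move=> uB ud homB; exists (a - b *m invmx d *m c) => // [|x Gx].
  have: block_mx 1%:M (- (b *m invmx d)) 0 1%:M *m block_mx a b c d \in unitmx.
    by rewrite unitmx_mul uB andbT unitmxE det_ublock !det1 mulr1 unitr1.
  rewrite mulmx_block !mul1mx !mul0mx !add0r !mulNmx -(mulmxA b _ d) mulVmx //.
  by rewrite mulmx1 subrr row_free_unit !unitmxE det_lblock unitrM => /andP[].
have := homB x Gx; rewrite !mulmx_block !(mul0mx, mulmx0, addr0, add0r).
case/eq_block_mx=> Ha Hb Hc Hd.
have Hd': rW x *m invmx d = invmx d *m rW x.
  by apply: (canRL (mulKmx ud)); rewrite mulmxA -Hd mulmxK.
rewrite mulmxBr mulmxBl Ha -!mulmxA -Hc !mulmxA Hb.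
by rewrite -(mulmxA b (rW x)) Hd' mulmxA.
Qed.

(** By Schur's lemma the W-to-W corner d of the isomorphism is invertible or
    zero. Matrices act on row vectors, so c is the block from W to V; let b' be
    the block from V to W of the inverse isomorphism. If d = 0 then c b' = 1,
    so that composing with the unipotent automorphism of V + W with block b'
    makes the corner equal to 1. *)
Lemma dadd_rsim_irrK U V W :
    mx_irreducible W -> mx_rsim (dadd_grepr U W) (dadd_grepr V W) ->
  mx_rsim U V.
Proof.
case: U V W => [m rU] [n rV] [k rW] /= irrW [B /addIn eq_mn].
subst n; rewrite row_free_unit => uB homB.
pose B' := invmx B.
have homB' x : x \in G -> block_mx (rV x) 0 0 (rW x) *m B'
                        = B' *m block_mx (rU x) 0 0 (rW x).
  by move=> Gx; apply: (canRL (mulKmx uB)); rewrite mulmxA -homB // mulmxK.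
have: B *m B' = 1%:M by rewrite mulmxV.
move: homB homB' uB; rewrite -[B]submxK -[B']submxK.
move: (ulsubmx B) (ursubmx B) (dlsubmx B) (drsubmx B) => a b c d.
move: (ulsubmx B') (ursubmx B') (dlsubmx B') (drsubmx B') => a' b' c' d'.
move=> homB homB' uB BB'.
have [d0 | nz_d] := eqVneq d 0; last first.
  apply: (dadd_rsim_unit_corner uB _ homB); apply: (mx_Schur irrW _ nz_d).
  apply/centgmxP=> x Gx; have := homB x Gx.
  rewrite !mulmx_block !(mul0mx, mulmx0, addr0, add0r).
  by case/eq_block_mx.
have cb' : c *m b' = 1%:M.
  move: BB'; rewrite mulmx_block d0 scalar_mx_block !mul0mx !addr0.
  by case/eq_block_mx.
pose E : 'M_(m + k) := block_mx 1%:M b' 0 1%:M.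
have uE : E \in unitmx by rewrite unitmxE det_ublock !det1 mulr1 unitr1.
have homE x : x \in G ->
    block_mx (rV x) 0 0 (rW x) *m E = E *m block_mx (rV x) 0 0 (rW x).
  move=> Gx; have := homB' x Gx; rewrite !mulmx_block.
  rewrite !(mul0mx, mulmx0, mulmx1, mul1mx, addr0, add0r).
  by case/eq_block_mx=> _ -> _ _.
have BE : block_mx a b c d *m E = block_mx a (a *m b' + b) c 1%:M.
  by rewrite mulmx_block !(mulmx0, mulmx1, addr0) cb' d0 addr0.
apply: (@dadd_rsim_unit_corner _ _ _ _ rW a (a *m b' + b) c 1%:M).
- by rewrite -BE unitmx_mul uB.
- exact: unitmx1.
by move=> x Gx; rewrite -BE mulmxA homB // -!mulmxA homE.
Qed.

Hypothesis charG : ([pchar K]^'.-group G)%g.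

(** Maschke's theorem, as an induction principle on the degree. *)
Lemma rep_class_ind (P : rep_semiring K G -> Prop) :
    P 0 -> (forall x y, P x -> P y -> P (x + y)) ->
    (forall W, mx_irreducible W -> P (rep_class W)) ->
  forall x, P x.
Proof.
move=> P0 PD Pirr; elim/rep_classW=> -[n rG].
have [m] := ubnP n; elim: m => // m IHm in n rG *; rewrite ltnS => le_nm.
have [n0 | n_gt0] := posnP n.
  suff ->: rep_class (Representation rG) = 0 by [].
  apply/rep_classP; subst n; exists 0 => // [|x _].
    by rewrite -row_leq_rank.
  by rewrite mulmx0 mul0mx.
have [irrG | /mx_irrP/not_andP[] //] := pselect (mx_irreducible rG).
  exact: (Pirr (Representation rG)).
case/existsNP=> U /not_implyP[modU] /not_implyP[nzU nfullU].
have [V modV eqUV dxUV] := mx_Maschke_pchar _ charG modU (submx1 U).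
have dimUV : (\rank U + \rank V = n)%N.
  by rewrite -(mxdirectP dxUV) /= eqUV mxrank1.
have ltU : (\rank U < n)%N.
  by rewrite ltn_neqAle rank_leq_col andbT; apply/negP.
have ltV : (\rank V < n)%N.
  by rewrite -[ltnRHS]dimUV -[ltnLHS]add0n ltn_add2r lt0n mxrank_eq0.
suff ->: rep_class (Representation rG) =
    rep_class (Representation (submod_repr modU)) +
    rep_class (Representation (submod_repr modV)).
  by apply: PD; apply: IHm; apply: leq_trans le_nm.
rewrite -rep_classD; apply/rep_classP.
apply: mx_rsim_trans (mx_rsim_sym (rsim_submod1 (mxmodule1 rG) _)) _ => //.
by apply: (mx_rsim_dadd _ eqUV dxUV);
  apply: (mx_rsim_refl (submod_repr _)).
Qed.

(** The Krull-Schmidt cancellation property: the elements that can be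
    cancelled are closed under sums. *)
Lemma rep_addrI : right_injective (@GRing.add (rep_semiring K G)).
Proof.
elim/rep_class_ind=> [|x y IHx IHy|W irrW] u v.
- by rewrite !add0r.
- by rewrite -!addrA => /IHx/IHy.
elim/rep_classW: u => U; elim/rep_classW: v => V.
rewrite ![rep_class W + _]addrC -!rep_classD => /rep_classP simUWV.
exact/rep_classP/(dadd_rsim_irrK irrW).
Qed.

Definition reg_rep : representation K G := Representation (regular_repr K G).

(** An irreducible representation is isomorphic to a submodule of the regular
    one, and so has a complement there; complements add up. *)
Lemma rep_dvd_reg x : exists y n, x + y = rep_class reg_rep *+ n.
Proof.
elim/rep_class_ind: x => [|x y [x' [n def_n]] [y' [m def_m]]|W irrW].
- by exists 0, 0; rewrite addr0.
- by exists (x' + y'), (n + m)%N; rewrite mulrnDr -def_n -def_m addrACA.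
have [U [modU simWU]] := rsim_regular_submod_pchar irrW charG.
have [V modV eqUV dxUV] := mx_Maschke_pchar _ charG modU (submx1 U).
exists (rep_class (Representation (submod_repr modV))), 1.
rewrite mulr1n -rep_classD; apply/esym/rep_classP.
apply: mx_rsim_trans (mx_rsim_sym (rsim_submod1 (mxmodule1 _) _)) _ => //.
apply: (mx_rsim_dadd _ eqUV _ (mx_rsim_sym simWU)) => //.
exact: (mx_rsim_refl (submod_repr _)).
Qed.

End Semisimple.

(** * Restrictions of the regular representation *)

Section RegularRestriction.

Variables (K : fieldType) (aT rT : finGroupType).
Variables (H : {group aT}) (G : {group rT}) (f g : {morphism H >-> rT}).
Hypotheses (sfG : H \subset (f @*^-1 G)%g) (sgG : H \subset (g @*^-1 G)%g).
Hypotheses (injf : ('injm f)%g) (injg : ('injm g)%g).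

Local Open Scope group_scope.

(** Through f, and likewise through g, right translation makes G a free H-set;
    both have |G : H| orbits, namely the left cosets of the image of H. A
    bijection beta between the two sets of orbits, together with a base point
    in each orbit, gives an isomorphism of H-sets: the point g(y) away from the
    base point of its orbit goes to the point f(y) away from the base point of
    the corresponding orbit. *)
Lemma free_translation_bij : exists h : rT -> rT,
  [/\ {in G, forall s, h s \in G}, {in G &, injective h}
    & {in G & H, forall s x, h (s * g x) = h s * f x}].
Proof.
have sfHG : f @* H \subset G by rewrite sub_morphim_pre.
have sgHG : g @* H \subset G by rewrite sub_morphim_pre.
pose Cf := enum (lcosets (f @* H) G); pose Cg := enum (lcosets (g @* H) G).
have eq_size : size Cf = size Cg.
  rewrite -!cardE !card_lcosets -!divgS //.
  by rewrite (card_injm injf) ?(card_injm injg).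
(* The default value of nth is never reached, the two lists having the same
   length. *)
pose beta C := nth (G : {set rT}) Cf (index C Cg).
have memCg s : s \in G -> s *: g @* H \in Cg.
  by move=> Gs; rewrite mem_enum; apply/lcosetsP; exists s.
have beta_mem s : s \in G -> beta (s *: g @* H) \in lcosets (f @* H) G.
  by move=> Gs; rewrite -mem_enum mem_nth // eq_size index_mem memCg.
have beta_inj s t : s \in G -> t \in G ->
    beta (s *: g @* H) = beta (t *: g @* H) -> s *: g @* H = t *: g @* H.
  move=> Gs Gt /eqP; rewrite nth_uniq ?enum_uniq ?eq_size ?index_mem ?memCg //.
  by move=> /eqP/(index_inj (G : {set rT}) (memCg s Gs) (memCg t Gt)).
pose r s := repr (s *: g @* H).
pose y s := invm injg ((r s)^-1 * s).
have rP s : (r s)^-1 * s \in g @* H.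
  have /lcosetP[z Hz ->] : r s \in s *: g @* H.
    exact: mem_repr (lcoset_refl _ _).
  by rewrite invMg -mulgA mulVg mulg1 groupV.
have yP s : y s \in H by rewrite -(im_invm injg) mem_morphim //= rP.
have yK s : r s * g (y s) = s by rewrite /y invmK ?mulKVg.
pose h s := repr (beta (s *: g @* H)) * f (y s).
have hP s : s \in G -> exists t,
    [/\ t \in G, beta (s *: g @* H) = t *: f @* H & h s \in t *: f @* H].
  move=> Gs; have /lcosetsP[t Gt def_t] := beta_mem s Gs; exists t; split=> //.
  rewrite /h def_t mem_lcoset mulgA groupM ?mem_morphim ?yP //.
  by rewrite -mem_lcoset (mem_repr t) ?lcoset_refl.
exists h; split=> [s Gs | s t Gs Gt eq_h | s x Gs Hx].
- have [t [Gt _ /lcosetP[z fHz ->]]] := hP s Gs.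
  by rewrite groupM // (fintype.subsetP sfHG).
- have [s' [_ Cs hs]] := hP s Gs; have [t' [_ Ct ht]] := hP t Gt.
  have eqC : s *: g @* H = t *: g @* H.
    apply: beta_inj => //; rewrite Cs Ct -(lcoset_eqP hs) eq_h.
    exact/lcoset_eqP.
  have eq_y : y s = y t.
    apply: (injmP injf); rewrite ?yP //.
    apply: (mulgI (repr (beta (s *: g @* H)))).
    by rewrite -[LHS]/(h s) eq_h /h eqC.
  by rewrite -(yK s) -(yK t) eq_y /r eqC.
have eqC : (s * g x) *: g @* H = s *: g @* H.
  by apply/lcoset_eqP; rewrite mem_lcoset mulKg mem_morphim.
suff eq_y : y (s * g x) = y s * x by rewrite /h eqC eq_y morphM ?yP // mulgA.
apply: (injmP injg); rewrite ?groupM ?yP //.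
apply: (mulgI (r s)); rewrite morphM ?yP // mulgA yK.
by rewrite -[RHS]yK /r eqC.
Qed.

(** Both sides permute the basis indexed by G, and the isomorphism of H-sets
    given by [free_translation_bij] matches the two permutation actions. *)
Lemma rep_res_reg :
  rep_res sfG (rep_class (reg_rep K G)) = rep_res sgG (rep_class (reg_rep K G)).
Proof.
have [h [hG inj_h hM]] := free_translation_bij.
rewrite !rep_resE; apply/esym/rep_classP.
pose hI (i : 'I_#|G|) := gring_index G (h (enum_val i)).
have hIK i : enum_val (hI i) = h (enum_val i).
  by rewrite gring_indexK // hG ?enum_valP.
have inj_hI : injective hI.
  move=> i j /(congr1 enum_val); rewrite !hIK => /inj_h eq_ij.
  by apply/enum_val_inj/eq_ij; apply: enum_valP.
apply: (@rsim_bij _ _ _ (res_grepr sgG (reg_rep K G))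
  (res_grepr sfG (reg_rep K G)) hI).
  exact: inj_card_bij.
move=> x Hx i j.
have Gf : f x \in G by case/morphpreP: (fintype.subsetP sfG x Hx).
have Gg : g x \in G by case/morphpreP: (fintype.subsetP sgG x Hx).
rewrite /= !mxE /=; congr (_ %:R); congr nat_of_bool.
rewrite -(inj_eq inj_hI) eq_sym [RHS]eq_sym; congr (_ == _).
apply: enum_val_inj; rewrite hIK !gring_indexK ?groupM ?hG ?enum_valP //.
by rewrite hM ?enum_valP.
Qed.

End RegularRestriction.

(** * Stable representations *)

Local Open Scope classical_set_scope.

Lemma pchar'_group_rmorph (K : fieldType) (L : numDomainType)
  (iota : {rmorphism K -> L}) (gT : finGroupType) (G : {group gT}) :
  ([pchar K]^'.-group G)%g.
Proof.
rewrite /pgroup pcharf'_nat -(fmorph_eq0 iota) rmorph_nat.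
by rewrite Num.Theory.pnatr_eq0 -lt0n cardG_gt0.
Qed.

Lemma vrep_res_gdiff (K : fieldType) (aT rT : finGroupType) (H : {group aT})
    (G : {group rT}) (f : {morphism H >-> rT}) (sHG : (H \subset f @*^-1 G)%g)
    (x : rep_semiring K G * rep_semiring K G) :
  vrep_res K sHG (gdiff x) = gdiff (rep_res sHG x.1, rep_res sHG x.2).
Proof. exact: groth_mapE. Qed.

Section Stable.

Variables (K : fieldType) (gT : finGroupType) (S : {group gT}).
Variable F : fusion_system S.

Lemma reg_stable : rep_class (reg_rep K S) \in rep_stable F.
Proof.
apply/rep_stableP=> P f Ff; apply: rep_res_reg; last exact: injm_idm.
by apply/injmP; case/fhom_inj: Ff.
Qed.

Hypothesis charK : forall P : {group gT}, ([pchar K]^'.-group P)%g.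

(** An equality of differences in the larger ring comes with an auxiliary
    summand that need not be stable; cancelling it brings the equality back to
    stable representations. *)
Lemma stable_groth_inj :
  injective (groth_map (stable_rep_incl K F)).
Proof.
elim/gdiffW=> -[a b]; elim/gdiffW=> -[c d]; rewrite !groth_mapE.
case/gdiffP=> k /=; rewrite ![_ + k]addrC => /(rep_addrI (charK S)) eq_v.
apply/gdiffP; exists 0; rewrite /= !addr0; apply: val_inj.
by rewrite !rmorphD.
Qed.

Lemma groth_map_stable u : groth_map (stable_rep_incl K F) u \in vrep_stable F.
Proof.
elim/gdiffW: u => -[[a Fa] [b Fb]]; rewrite groth_mapE /=.
apply/vrep_stableP=> P f Ff; rewrite !vrep_res_gdiff /=.
by rewrite (elimT (rep_stableP _ _) Fa) (elimT (rep_stableP _ _) Fb).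
Qed.

(** Writing b + b' = n reg, the class a - b is (a + b') - n reg. Stability of
    a - b and of b + b' give that of a + b' up to the summand
    res_f b + res_P b, which cancels. *)
Lemma vrep_stable_diff u : u \in vrep_stable F ->
  exists v, u = groth_map (stable_rep_incl K F) v.
Proof.
elim/gdiffW: u => -[a b] /vrep_stableP Fab.
have [b' [n def_b']] := rep_dvd_reg (charK S) b.
have Fn : rep_class (reg_rep K S) *+ n \in rep_stable F.
  exact/rpredMn/reg_stable.
have Fa : a + b' \in rep_stable F.
  apply/rep_stableP=> P f Ff.
  have := Fab P f Ff; rewrite !vrep_res_gdiff => /gdiffP[k] /=.
  rewrite ![_ + k]addrC => /(rep_addrI (charK P)) eq_ab.
  have := elimT (rep_stableP _ _) Fn P f Ff; rewrite -def_b' !rmorphD /=.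
  set sF := fhom_im Ff in eq_ab *; set sI := fhom_dom Ff in eq_ab *.
  move=> eq_bb'.
  apply: (@rep_addrI _ _ _ (charK P) (rep_res sF b + rep_res sI b)).
  transitivity
    ((rep_res sF a + rep_res sI b) + (rep_res sF b + rep_res sF b')).
    by ring.
  by rewrite eq_ab eq_bb'; ring.
exists (gdiff (StableRep Fa, StableRep Fn)); rewrite groth_mapE /=.
by apply/gdiffP; exists 0; rewrite /= -def_b'; ring.
Qed.

End Stable.

Theorem proposition3p4 (R : realType) (K : fieldType)
    (iota : {rmorphism K -> R[i]}) (p : nat) (gT : finGroupType)
    (S : {group gT}) (F : fusion_system S) :
  prime p -> (p.-group S)%g -> saturated F p ->
  set_bij [set: groth (stable_rep_semiring K F)]
          [set x : rep_ring K S | x \in vrep_stable F]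
          (groth_map (stable_rep_incl K F)).
Proof.
move=> _ _ _; have charK := pchar'_group_rmorph iota.
split=> [u _|u v _ _|u /= Fu]; first exact: groth_map_stable.
  exact: stable_groth_inj.
by have [v ->] := vrep_stable_diff (charK _) Fu; exists v.
Qed.
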